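(* Let $X$ be a compact metric space with the positivity property $\mathbf{POS}^X$, and let $f$ be a Z-stable, uniformly continuous mapping of $X$ into a normed space $Y$ such that $Z_f=\{x\in X: f(x)=0\}$ is inhabited and located in $X$. Then $f$ is uniformly Z-stable on $X$.
   Context: The setting is Bishop-style constructive mathematics (BISH): intuitionistic logic together with dependent choice; neither the law of excluded middle, nor LPO, nor Markov's principle may be used. A metric space is compact if it is complete and totally bounded. $\rho$ denotes the metric on $X$. For $x\in X$, $S\subset X$ and $\varepsilon>0$, the expression $\rho(x,S)<\varepsilon$ means that there exists $y\in S$ with $\rho(x,y)<\varepsilon$. A subset $S$ of $X$ is located if the distance $\rho(x,S)=\inf\{\rho(x,y):y\in S\}$ exists for each $x\in X$. For $f:X\to Y$ with zero set $Z_f=\{x\in X:f(x)=0\}$: - $f$ is Z-stable at the point $x\in X$ if for each $\varepsilon>0$ there exists $\delta>0$ such that if $\|f(x)\|<\delta$, then $\rho(x,Z_f)<\varepsilon$; - $f$ is Z-stable (on $X$) if it is Z-stable at each point of $X$; - $f$ is uniformly Z-stable on $X$ if for each $\varepsilon>0$ there exists $\delta>0$ such that for each $x\in X$, if $\|f(x)\|<\delta$, then $\rho(x,Z_f)<\varepsilon$. Positivity property $\mathbf{POS}^X$: if $g:X\to\mathbf{R}$ is uniformly continuous and positive-valued ($g(x)>0$ for each $x\in X$), then $\inf_X g$ exists and is positive. Here $m=\inf_X g$ means that $m\le g(x)$ for all $x\in X$ and that for each $\varepsilon>0$ there exists $x\in X$ with $g(x)<m+\varepsilon$. *)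

(* Defs.v *)
(** Bishop-style constructive analysis over an arbitrary structure [R] of
    constructive reals from the Stdlib.  Logic is read as propositions-as-types:
    "there exists" is the sigma type, so that a modulus, an approximation or an
    infimum is data, as in Bishop (and dependent choice holds).  The strict order
    of [R] is itself informative ([CRlt] lives in [Set]), while [<=] and [==]
    are negative and live in [Prop].  Sets are types with a defined equality. *)
From Stdlib Require Import QArith Arith List Setoid Morphisms.
From Stdlib Require Import ConstructiveReals ConstructiveAbs.

Set Implicit Arguments.
Unset Strict Implicit.
Unset Printing Implicit Defensive.

Local Open Scope ConstructiveReals.

(** Compatibility of [dist] with [ms_eq] follows from the triangle inequality. *)
Record MetricSpace (R : ConstructiveReals) : Type := {
  ms_car :> Type;
  ms_eq : ms_car -> ms_car -> Prop;
  ms_eq_equiv : Equivalence ms_eq;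
  dist : ms_car -> ms_car -> CRcarrier R;
  dist_nonneg : forall x y, 0 <= dist x y;
  dist_eq0 : forall x y, dist x y == 0 <-> ms_eq x y;
  dist_sym : forall x y, dist x y == dist y x;
  dist_triangle : forall x y z, dist x z <= dist x y + dist y z
}.

Record NormedSpace (R : ConstructiveReals) : Type := {
  ns_car :> Type;
  ns_eq : ns_car -> ns_car -> Prop;
  ns_eq_equiv : Equivalence ns_eq;
  ns_zero : ns_car;
  ns_add : ns_car -> ns_car -> ns_car;
  ns_opp : ns_car -> ns_car;
  ns_scale : CRcarrier R -> ns_car -> ns_car;
  norm : ns_car -> CRcarrier R;
  ns_add_proper : Proper (ns_eq ==> ns_eq ==> ns_eq) ns_add;
  ns_opp_proper : Proper (ns_eq ==> ns_eq) ns_opp;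
  ns_scale_proper : Proper (CReq R ==> ns_eq ==> ns_eq) ns_scale;
  norm_proper : Proper (ns_eq ==> CReq R) norm;
  ns_addA : forall x y z,
    ns_eq (ns_add x (ns_add y z)) (ns_add (ns_add x y) z);
  ns_addC : forall x y, ns_eq (ns_add x y) (ns_add y x);
  ns_add0 : forall x, ns_eq (ns_add x ns_zero) x;
  ns_addN : forall x, ns_eq (ns_add x (ns_opp x)) ns_zero;
  ns_scaleA : forall a b x,
    ns_eq (ns_scale a (ns_scale b x)) (ns_scale (a * b) x);
  ns_scale1 : forall x, ns_eq (ns_scale 1 x) x;
  ns_scaleDr : forall a x y,
    ns_eq (ns_scale a (ns_add x y)) (ns_add (ns_scale a x) (ns_scale a y));
  ns_scaleDl : forall a b x,
    ns_eq (ns_scale (a + b) x) (ns_add (ns_scale a x) (ns_scale b x));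
  norm_nonneg : forall x, 0 <= norm x;
  norm_eq0 : forall x, norm x == 0 <-> ns_eq x ns_zero;
  norm_scale : forall a x, norm (ns_scale a x) == CRabs R a * norm x;
  norm_triangle : forall x y, norm (ns_add x y) <= norm x + norm y
}.

Arguments ms_eq {R m} _ _.
Arguments dist {R m} _ _.
Arguments ns_eq {R n} _ _.
Arguments ns_zero {R} n.
Arguments ns_add {R n} _ _.
Arguments ns_opp {R n} _.
Arguments ns_scale {R n} _ _.
Arguments norm {R n} _.
Arguments dist_nonneg {R m} x y _.
Arguments dist_triangle {R m} x y z _.
Arguments norm_nonneg {R n} x _.
Arguments norm_triangle {R n} x y _.

Section RealMetric.
Variable R : ConstructiveReals.

Lemma real_dist_eq0 (x y : CRcarrier R) : CRabs R (x - y) == 0 <-> x == y.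
Proof.
split; intro H.
- assert (L : x <= y).
  { apply (CRplus_le_reg_r (- y)). rewrite CRplus_opp_r.
    rewrite <- H. exact (CRle_abs (x - y)). }
  assert (L' : y <= x).
  { apply (CRplus_le_reg_r (- x)). rewrite CRplus_opp_r.
    rewrite <- H, CRabs_minus_sym. exact (CRle_abs (y - x)). }
  split; assumption.
- rewrite H. unfold CRminus. rewrite CRplus_opp_r.
  apply CRabs_right. apply CRle_refl.
Qed.

Lemma real_dist_triangle (x y z : CRcarrier R) :
  CRabs R (x - z) <= CRabs R (x - y) + CRabs R (y - z).
Proof.
setoid_replace (x - z) with ((x - y) + (y - z)).
- apply CRabs_triang.
- unfold CRminus. rewrite CRplus_assoc, <- (CRplus_assoc (- y)).
  now rewrite CRplus_opp_l, CRplus_0_l.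
Qed.

Definition real_metric : MetricSpace R :=
  {| ms_car := CRcarrier R;
     ms_eq := CReq R;
     ms_eq_equiv := @CReq_rel R;
     dist := fun x y => CRabs R (x - y);
     dist_nonneg := fun x y => CRabs_pos (x - y);
     dist_eq0 := real_dist_eq0;
     dist_sym := @CRabs_minus_sym R;
     dist_triangle := real_dist_triangle |}.
End RealMetric.

Section NormMetric.
Variables (R : ConstructiveReals) (Y : NormedSpace R).

#[local] Existing Instance ns_eq_equiv.
#[local] Existing Instance ns_add_proper.
#[local] Existing Instance ns_opp_proper.
#[local] Existing Instance ns_scale_proper.
#[local] Existing Instance norm_proper.

Let sub (x y : Y) : Y := ns_add x (ns_opp y).

Lemma ns_subDsub (x y z : Y) :
  ns_eq (ns_add (sub x y) (sub y z)) (sub x z).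
Proof.
unfold sub. rewrite <- ns_addA, (ns_addA (ns_opp y)).
rewrite (ns_addC (ns_opp y) y), ns_addN, (ns_addC (ns_zero Y)).
now rewrite ns_add0.
Qed.

Lemma ns_sub_eq0 (x y : Y) : ns_eq (sub x y) (ns_zero Y) <-> ns_eq x y.
Proof.
unfold sub; split; intro H.
- rewrite <- (ns_add0 x), <- (ns_addN y), (ns_addC y), ns_addA, H, ns_addC.
  apply ns_add0.
- rewrite H. apply ns_addN.
Qed.

Lemma ns_add_self_eq0 (x : Y) : ns_eq (ns_add x x) x -> ns_eq x (ns_zero Y).
Proof.
intro H. rewrite <- (ns_add0 x), <- (ns_addN x), ns_addA, H. reflexivity.
Qed.

Lemma ns_scale0 (x : Y) : ns_eq (ns_scale 0 x) (ns_zero Y).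
Proof.
apply ns_add_self_eq0. rewrite <- ns_scaleDl. now rewrite CRplus_0_l.
Qed.

Lemma ns_opp_unique (x y : Y) :
  ns_eq (ns_add x y) (ns_zero Y) -> ns_eq y (ns_opp x).
Proof.
intro H. rewrite <- (ns_add0 (ns_opp x)), <- H, ns_addA.
rewrite (ns_addC (ns_opp x)), ns_addN, ns_addC. symmetry; apply ns_add0.
Qed.

Lemma norm_opp (x : Y) : norm (ns_opp x) == norm x.
Proof.
assert (E : ns_eq (ns_scale (- (1)) x) (ns_opp x)).
{ apply ns_opp_unique. rewrite <- (ns_scale1 x) at 1.
  rewrite <- ns_scaleDl, CRplus_opp_r. apply ns_scale0. }
rewrite <- E, norm_scale, CRabs_opp, CRabs_right.
- apply CRmult_1_l.
- apply CRlt_asym, CRzero_lt_one.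
Qed.

Lemma norm_dist_eq0 (x y : Y) : norm (sub x y) == 0 <-> ns_eq x y.
Proof. rewrite norm_eq0. apply ns_sub_eq0. Qed.

Lemma norm_dist_sym (x y : Y) : norm (sub x y) == norm (sub y x).
Proof.
rewrite <- (norm_opp (sub y x)). apply norm_proper, ns_opp_unique.
rewrite ns_subDsub. apply ns_addN.
Qed.

Lemma norm_dist_triangle (x y z : Y) :
  norm (sub x z) <= norm (sub x y) + norm (sub y z).
Proof. rewrite <- (ns_subDsub x y z). apply norm_triangle. Qed.

Definition norm_metric : MetricSpace R :=
  {| ms_car := Y;
     ms_eq := ns_eq;
     ms_eq_equiv := ns_eq_equiv Y;
     dist := fun x y => norm (ns_add x (ns_opp y));
     dist_nonneg := fun x y => norm_nonneg (ns_add x (ns_opp y));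
     dist_eq0 := norm_dist_eq0;
     dist_sym := norm_dist_sym;
     dist_triangle := norm_dist_triangle |}.
End NormMetric.

Definition is_inf (R : ConstructiveReals) (A : Type) (g : A -> CRcarrier R)
    (m : CRcarrier R) : Type :=
  (forall x, m <= g x) *
  (forall eps, 0 < eps -> {x : A & g x < m + eps}).

Section MetricNotions.
Variables (R : ConstructiveReals) (X : MetricSpace R).

Definition cauchy (u : nat -> X) : Type :=
  forall eps : CRcarrier R, 0 < eps ->
  {N : nat & forall i j, (N <= i)%nat -> (N <= j)%nat ->
             dist (u i) (u j) < eps}.

Definition converges (u : nat -> X) (l : X) : Type :=
  forall eps : CRcarrier R, 0 < eps ->
  {N : nat & forall i, (N <= i)%nat -> dist (u i) l < eps}.

Definition complete : Type :=
  forall u : nat -> X, cauchy u -> {l : X & converges u l}.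

Definition totally_bounded : Type :=
  forall eps : CRcarrier R, 0 < eps ->
  {l : list X & forall x : X, {y : X & (In y l * (dist x y < eps))%type}}.

Definition compact : Type := (complete * totally_bounded)%type.

Definition inhabited_subset (S : X -> Type) : Type := {x : X & S x}.

Definition set_dist_lt (x : X) (S : X -> Type) (eps : CRcarrier R) : Type :=
  {y : X & (S y * (dist x y < eps))%type}.

Definition located (S : X -> Type) : Type :=
  forall x : X,
  {d : CRcarrier R & is_inf (fun y : {y : X & S y} => dist x (projT1 y)) d}.
End MetricNotions.

(** Such an [f] is automatically compatible with the equalities of [X], [X']. *)
Definition uniformly_continuous (R : ConstructiveReals) (X X' : MetricSpace R)
    (f : X -> X') : Type :=
  forall eps : CRcarrier R, 0 < eps ->
  {delta : CRcarrier R &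
    ((0 < delta) *
     (forall x y : X, dist x y < delta -> dist (f x) (f y) < eps))%type}.

Definition POS (R : ConstructiveReals) (X : MetricSpace R) : Type :=
  forall g : X -> real_metric R,
  uniformly_continuous g -> (forall x : X, 0 < g x) ->
  {m : CRcarrier R & (is_inf g m * (0 < m))%type}.

Section ZStability.
Variables (R : ConstructiveReals) (X : MetricSpace R) (Y : NormedSpace R).
Variable f : X -> Y.

Definition zero_set (x : X) : Type := ns_eq (f x) (ns_zero Y).

Definition z_stable_at (x : X) : Type :=
  forall eps : CRcarrier R, 0 < eps ->
  {delta : CRcarrier R &
    ((0 < delta) * (norm (f x) < delta -> set_dist_lt x zero_set eps))%type}.

Definition z_stable : Type := forall x : X, z_stable_at x.

Definition uniformly_z_stable : Type :=
  forall eps : CRcarrier R, 0 < eps ->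
  {delta : CRcarrier R &
    ((0 < delta) *
     (forall x : X, norm (f x) < delta -> set_dist_lt x zero_set eps))%type}.
End ZStability.

(* Main.v *)
Require Import Defs.
From Stdlib Require Import ConstructiveReals.
From Stdlib Require Import ConstructiveAbs ConstructiveMinMax.

(** For [eps > 0] apply the positivity property to
    [g x = max (norm (f x)) (eps - d x)], where [d x] is the distance from [x]
    to the zero set.  Z-stability at [x] makes [g x] positive: if [d x] is bounded
    away from 0 then so is [norm (f x)].  The infimum [m > 0] of [g] is the required
    [delta], because [norm (f x) < m <= g x] forces [d x < eps]. *)

Local Open Scope ConstructiveReals.

Lemma CRplus_cancel_minus {R : ConstructiveReals} (x y : CRcarrier R) :
  x - y + y == x.
Proof.
  unfold CRminus. now rewrite CRplus_assoc, CRplus_opp_l, CRplus_0_r.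
Qed.

Lemma CRlt_minus_plus {R : ConstructiveReals} (x y z : CRcarrier R) :
  x - y < z -> x < z + y.
Proof.
  intro H. apply (CRplus_lt_compat_r y) in H.
  now rewrite CRplus_cancel_minus in H.
Qed.

Lemma CRlt_plus_minus {R : ConstructiveReals} (x y z : CRcarrier R) :
  x < z + y -> x - y < z.
Proof.
  intro H. apply (CRplus_lt_reg_r y). now rewrite CRplus_cancel_minus.
Qed.

(** Cotransitivity splits [x < z] at [y]: the case [y < z] would put both entries of the maximum
    below [z], against [z <= CRmax x y]. *)
Lemma CRlt_of_lt_max {R : ConstructiveReals} (x y z : CRcarrier R) :
  x < z -> z <= CRmax x y -> x < y.
Proof.
  intros Hx Hz.
  destruct (CRltLinear R) as [_ cotrans].
  destruct (cotrans x y z Hx) as [H | H]; [exact H |].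
  destruct Hz. now apply CRmax_lub_lt.
Qed.

(** This is the triangle inequality of [norm_metric] with third point zero, once the distance to
    zero is identified with the norm. *)
Lemma norm_le_add_dist {R : ConstructiveReals} {Y : NormedSpace R} (x y : Y) :
  norm x <= norm y + norm (ns_add x (ns_opp y)).
Proof.
  assert (E : forall u : Y, norm (ns_add u (ns_opp (ns_zero Y))) == norm u).
  { intro u. apply norm_proper.
    pose proof (ns_eq_equiv Y) as eqv.
    transitivity (ns_add (ns_add u (ns_opp (ns_zero Y))) (ns_zero Y)).
    - symmetry. apply ns_add0.
    - transitivity (ns_add u (ns_add (ns_opp (ns_zero Y)) (ns_zero Y))).
      + symmetry. apply ns_addA.
      + transitivity (ns_add u (ns_zero Y)); [| apply ns_add0].
        apply ns_add_proper; [reflexivity |].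
        transitivity (ns_add (ns_zero Y) (ns_opp (ns_zero Y)));
          [apply ns_addC | apply ns_addN]. }
  pose proof (@norm_dist_triangle R Y x y (ns_zero Y)) as T.
  now rewrite !E, CRplus_comm in T.
Qed.

(** If the inequality failed, the excess would serve as tolerance for the infimum at [y]: the
    resulting point [z] of [S] would be closer to [x] than [dx]. *)
Lemma located_dist_lipschitz {R : ConstructiveReals} {X : MetricSpace R}
    {S : X -> Type} (S_located : located S) (x y : X) :
  projT1 (S_located x) <= projT1 (S_located y) + dist x y.
Proof.
  destruct (S_located x) as [dx [lbx ?]], (S_located y) as [dy [? appy]]; simpl.
  intro H.
  destruct (appy (dx - (dy + dist x y)) (CRlt_minus _ _ H)) as [z Hz].
  apply (lbx z).
  apply (CRle_lt_trans _ _ _ (dist_triangle x y (projT1 z))).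
  apply (CRplus_lt_compat_r (dy + dist x y)) in Hz.
  rewrite CRplus_assoc, CRplus_cancel_minus in Hz.
  apply (CRplus_lt_reg_l R dy).
  rewrite <- (CRplus_assoc dy), (CRplus_comm (dy + dist x y)).
  exact Hz.
Qed.

(** A one-sided bound suffices because [x] and [y] can be exchanged. *)
Lemma uniformly_continuous_intro {R : ConstructiveReals} {X : MetricSpace R}
    (g : X -> real_metric R) :
  (forall eps : CRcarrier R, 0 < eps ->
   {delta : CRcarrier R &
     ((0 < delta) *
      (forall x y : X, dist x y < delta -> (g x < g y + eps)%ConstructiveReals))%type}) ->
  uniformly_continuous g.
Proof.
  intros H eps eps_pos. destruct (H eps eps_pos) as [delta [delta_pos Hd]].
  exists delta. split; [exact delta_pos |]. intros x y xy. simpl.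
  apply CRabs_def1.
  - apply CRlt_plus_minus. rewrite CRplus_comm. now apply Hd.
  - assert (E : - (g x - g y) == g y - g x).
    { unfold CRminus. now rewrite CRopp_plus_distr, CRopp_involutive, CRplus_comm. }
    rewrite E. apply CRlt_plus_minus. rewrite CRplus_comm. apply Hd.
    now rewrite dist_sym.
Qed.

Theorem proposition3p2 (R : ConstructiveReals)
    (X : MetricSpace R) (Y : NormedSpace R) (f : X -> Y)
    (X_compact : compact X) (X_POS : POS X)
    (f_uc : uniformly_continuous (X' := norm_metric Y) f) (f_stable : z_stable f)
    (Zf_inhabited : inhabited_subset (zero_set f))
    (Zf_located : located (zero_set f)) :
  uniformly_z_stable f.
Proof.
  intros eps eps_pos.
  pose (d := fun x => projT1 (Zf_located x)).
  pose (g := fun x => CRmax (norm (f x)) (eps - d x)).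
  destruct (CRltLinear R) as [_ cotrans].
  assert (g_uc : uniformly_continuous (X' := real_metric R) g).
  { apply uniformly_continuous_intro. intros e e_pos.
    destruct (f_uc e e_pos) as [delta [delta_pos Hf]].
    (* [delta] controls the norm entry of the maximum; [e] controls [eps - d x], as [d] is
       1-Lipschitz. *)
    exists (CRmin delta e). split; [now apply CRmin_lt |].
    intros x y xy. apply CRmax_lub_lt.
    - apply (CRle_lt_trans _ _ _ (norm_le_add_dist (f x) (f y))).
      apply CRplus_le_lt_compat; [apply CRmax_l |].
      apply Hf, (CRlt_le_trans _ _ _ xy), CRmin_l.
    - apply (CRlt_le_trans _ (eps - d y + e)).
      + apply CRlt_plus_minus.
        unfold CRminus. rewrite !CRplus_assoc.
        rewrite <- (CRplus_0_r eps) at 1.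
        apply CRplus_lt_compat_l, (CRplus_lt_reg_l R (d y)).
        rewrite <- CRplus_assoc, CRplus_opp_r, CRplus_0_r, CRplus_0_l.
        apply (CRle_lt_trans _ _ _ (located_dist_lipschitz Zf_located y x)).
        rewrite (CRplus_comm e). apply CRplus_lt_compat_l.
        rewrite dist_sym. apply (CRlt_le_trans _ _ _ xy), CRmin_r.
      + apply CRplus_le_compat_r, CRmax_r. }
  assert (g_pos : forall x, 0 < g x).
  (* Comparing [d x] with a single number is undecidable; the gap between [q] and [eps] allows the
     split [q < d x] or [d x < eps]. *)
  { intro x. destruct (CR_Q_dense R _ _ eps_pos) as [q [q_pos q_eps]].
    destruct (cotrans _ (d x) _ q_eps) as [far | near].
    - destruct (f_stable x _ q_pos) as [delta [delta_pos Hd]].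
      destruct (cotrans _ (norm (f x)) _ delta_pos) as [nz | small].
      + apply (CRlt_le_trans _ _ _ nz), CRmax_l.
      (* Impossible case: stability gives a zero within [q] of [x], although [q < d x]. *)
      + destruct (Hd small) as [y [Zy xy]].
        destruct (fst (projT2 (Zf_located x)) (existT _ y Zy)).
        exact (CRlt_trans _ _ _ xy far).
    - apply (CRlt_le_trans _ _ _ (CRlt_minus _ _ near)), CRmax_r. }
  destruct (X_POS g g_uc g_pos) as [m [[m_le _] m_pos]].
  exists m. split; [exact m_pos |]. intros x small.
  assert (gap : 0 < eps - d x).
  { apply (CRle_lt_trans _ _ _ (norm_nonneg (f x))).
    exact (CRlt_of_lt_max _ _ _ small (m_le x)). }
  (* With tolerance [eps - d x], the infimum yields a zero at distance below [d x + (eps - d x)],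
     which is [eps]. *)
  destruct (snd (projT2 (Zf_located x)) _ gap) as [[y Zy] Hy].
  exists y. split; [exact Zy |].
  apply (CRlt_le_trans _ _ _ Hy). fold (d x).
  rewrite CRplus_comm, CRplus_cancel_minus. apply CRle_refl.
Qed.
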